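(* For every $n\ge 2$ the Sierpinski gasket graph $S_n$ is a fractal, with $\dim_L(S_n)=1$ and $\dim_H(S_n)=2$.
   Context: Sierpinski gasket graphs: define tetrads $T_n=(S_n,x_1,x_2,x_3)$, where $S_n$ is a graph and $x_1,x_2,x_3$ are distinct vertices of $S_n$ called contact vertices. $S_1$ is the triangle $K_3$ with vertices $x_1,x_2,x_3$, and $T_1=(S_1,x_1,x_2,x_3)$. The graph $S_{n+1}$ is obtained from three disjoint copies $(S_n,x_1,x_2,x_3)$, $(S'_n,x'_1,x'_2,x'_3)$, $(S''_n,x''_1,x''_2,x''_3)$ of $T_n$ by identifying $x_2$ with $x'_1$, $x'_3$ with $x''_2$, and $x_3$ with $x''_1$; and $T_{n+1}=(S_{n+1},x_1,x'_2,x''_3)$. A clique $k$-cover of a graph $G$ is a family of cliques of $G$ such that every edge of $G$ lies in at least one of them and every vertex belongs to at most $k$ of them. The rank dimension $\dim_R(G)$ is the minimal positive integer $k$ such that $G$ has a clique $k$-cover. The categorical product $G_1\times G_2$ has vertex set $V(G_1)\times V(G_2)$, with $(u_1,u_2),(v_1,v_2)$ adjacent iff $u_1v_1\in E(G_1)$ and $u_2v_2\in E(G_2)$. The Prague dimension $\dim_P(H)$ is the minimal positive integer $d$ such that $H$ is isomorphic to an induced subgraph of a categorical product of $d$ complete graphs. Put $\dim_L(G)=\dim_R(G)-1$ and $\dim_H(G)=\dim_P(\overline{G})-1$, where $\overline G$ is the complement of $G$. A graph $G$ is a fractal if $\dim_L(G)<\dim_H(G)$. *)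

(* Defs.v *)
From HB Require Import structures.
From mathcomp Require Import all_boot.
From mathcomp Require Import boolp.

Set Implicit Arguments.
Unset Strict Implicit.
Unset Printing Implicit Defensive.

Local Open Scope quotient_scope.

(** * Finite simple graphs *)

Record sgraph := SGraph {
  vertex :> finType;
  adj : rel vertex;
  adj_sym : symmetric adj;
  adj_irrefl : irreflexive adj }.

Arguments adj {G} : rename.

Definition giso (G H : sgraph) : Prop :=
  exists f : G -> H, bijective f /\ {mono f : u v / adj u v}.

Section Complete.
Variable m : nat.
Let kadj : rel 'I_m := fun u v => u != v.

Fact complete_sym : symmetric kadj.
Proof. by move=> u v; rewrite /kadj eq_sym. Qed.

Fact complete_irrefl : irreflexive kadj.
Proof. by move=> u; rewrite /kadj eqxx. Qed.

Definition complete : sgraph := SGraph complete_sym complete_irrefl.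
End Complete.

Section Complement.
Variable G : sgraph.
Let cadj : rel G := fun u v => (u != v) && ~~ adj u v.

Fact compl_sym : symmetric cadj.
Proof. by move=> u v; rewrite /cadj eq_sym adj_sym. Qed.

Fact compl_irrefl : irreflexive cadj.
Proof. by move=> u; rewrite /cadj eqxx. Qed.

Definition compl : sgraph := SGraph compl_sym compl_irrefl.
End Complement.

Section Induced.
Variables (G : sgraph) (A : {set G}).
Let iadj : rel {x : G | x \in A} := fun u v => adj (val u) (val v).

Fact induced_sym : symmetric iadj.
Proof. by move=> u v; rewrite /iadj adj_sym. Qed.

Fact induced_irrefl : irreflexive iadj.
Proof. by move=> u; rewrite /iadj adj_irrefl. Qed.

Definition induced : sgraph := SGraph induced_sym induced_irrefl.
End Induced.

Section CategoricalProduct.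
Variables G1 G2 : sgraph.
Let padj : rel (G1 * G2)%type := fun u v => adj u.1 v.1 && adj u.2 v.2.

Fact cprod_sym : symmetric padj.
Proof. by move=> u v; rewrite /padj [adj u.1 _]adj_sym [adj u.2 _]adj_sym. Qed.

Fact cprod_irrefl : irreflexive padj.
Proof. by move=> u; rewrite /padj adj_irrefl. Qed.

Definition cprod : sgraph := SGraph cprod_sym cprod_irrefl.
End CategoricalProduct.

(* K_m x K_(s_1) x ... x K_(s_r): a product of (size s).+1 complete graphs. *)
Fixpoint complete_prod (m : nat) (s : seq nat) : sgraph :=
  if s is m' :: s' then cprod (complete m) (complete_prod m' s')
  else complete m.

(** * Minimal positive integer with a given property *)

Section MinPos.
Variable P : nat -> Prop.
Hypothesis exP : exists k, 0 < k /\ P k.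

Fact min_pos_ex : exists k, (0 < k) && `[< P k >].
Proof. by case: exP => k [k0 Pk]; exists k; rewrite k0; apply/asboolP. Qed.

Definition min_pos : nat := ex_minn min_pos_ex.

Lemma min_posP :
  [/\ 0 < min_pos, P min_pos & forall k, 0 < k -> P k -> min_pos <= k].
Proof.
rewrite /min_pos; case: ex_minnP => k /andP[k0 /asboolP Pk] kmin.
by split=> // j j0 Pj; apply: kmin; rewrite j0; apply/asboolP.
Qed.
End MinPos.

(** * Rank dimension *)

Definition clique (G : sgraph) (C : {set G}) : Prop :=
  {in C &, forall u v, u != v -> adj u v}.

(* The family is a list, so repeated members count with multiplicity. *)
Definition clique_cover (G : sgraph) (k : nat) (F : seq {set G}) : Prop :=
  [/\ {in F, forall C, clique C},
      forall u v : G, adj u v -> exists2 C, C \in F & (u \in C) && (v \in C)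
    & forall v : G, count (fun C : {set G} => v \in C) F <= k].

Definition has_clique_cover (G : sgraph) (k : nat) : Prop :=
  exists F : seq {set G}, clique_cover k F.

Fact has_clique_cover_ex (G : sgraph) :
  exists k, 0 < k /\ has_clique_cover G k.
Proof.
pose F := [seq [set e.1; e.2] | e : G * G <- enum [pred e : G * G | adj e.1 e.2]].
exists (size F).+1; split=> //; exists F; split.
- move=> C /mapP[[a b]]; rewrite mem_enum inE /= => ab -> u v.
  rewrite !inE => /orP[]/eqP-> /orP[]/eqP->; rewrite ?eqxx // => _.
  by rewrite adj_sym.
- move=> u v uv; exists [set u; v]; last by rewrite !inE !eqxx orbT.
  by apply/mapP; exists (u, v); rewrite // mem_enum.
- by move=> v; apply: leq_trans (count_size _ _) _.
Qed.

Definition dim_R (G : sgraph) : nat := min_pos (has_clique_cover_ex G).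

(** * Prague dimension *)

Definition embeds_in_product (H : sgraph) (d : nat) : Prop :=
  exists (m : nat) (s : seq nat), (size s).+1 = d /\
    exists A : {set complete_prod m s}, giso H (induced A).

Lemma giso_induced (G H : sgraph) (f : H -> G) :
  injective f -> {mono f : u v / adj u v} -> exists A : {set G}, giso H (induced A).
Proof.
move=> f_inj f_mono; exists [set f x | x in H].
have fA x : f x \in [set f x | x in H] by apply: imset_f.
pose g x : induced [set f x | x in H] := exist _ (f x) (fA x).
exists g; split; last by move=> u v; apply: f_mono.
have g_inj : injective g by move=> u v /(congr1 val) /f_inj.
apply: inj_card_bij => //.
by rewrite card_sig (eq_card (B := [set f x | x in H])) // card_imset.
Qed.

(* Every H embeds: use the identity colouring and, for each non-edge {u, v},
   the colouring of the vertices that only merges v with u.  *)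
Fact embeds_in_product_ex (H : sgraph) :
  exists d, 0 < d /\ embeds_in_product H d.
Proof.
pose h (e : H * H) w := if (w == e.2) && ~~ adj e.1 e.2 then e.1 else w.
have main (L : seq (H * H)) : exists f : H -> complete_prod #|H| (nseq (size L) #|H|),
    injective f /\ forall u v, adj (f u) (f v) =
      (u != v) && all (fun e => h e u != h e v) L.
  elim: L => [|e L [f [f_inj fE]]].
    exists (@enum_rank H); split; first exact: enum_rank_inj.
    by move=> u v; rewrite /adj /= (inj_eq enum_rank_inj) andbT.
  exists (fun w => (enum_rank (h e w), f w)); split; first by move=> u v [_ /f_inj].
  move=> u v; rewrite {1}/adj /= fE (inj_eq enum_rank_inj).
  by rewrite andbCA.
have [f [f_inj fE]] := main (enum [set: H * H]).
exists (size (nseq (size (enum [set: H * H])) #|H|)).+1; split=> //.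
exists #|H|, (nseq (size (enum [set: H * H])) #|H|); split=> //.
apply: (giso_induced f_inj) => u v; rewrite fE.
have [->|uv] /= := eqVneq u v; first by rewrite adj_irrefl.
apply/allP/idP => [/(_ (u, v))|auv [a b] _].
  rewrite mem_enum inE /h /= eqxx (negPf uv) /= => /(_ isT).
  by case: (adj u v); rewrite ?eqxx.
rewrite /h /=; case: (boolP (adj a b)) => ab; rewrite ?andbF ?andbT //.
case: (eqVneq u b) => [ub|_]; case: (eqVneq v b) => [vb|_] //.
- by rewrite ub vb eqxx in uv.
- by apply: contraNneq ab => ->; rewrite adj_sym -ub.
- by apply: contraNneq ab => <-; rewrite -vb.
Qed.

Definition dim_P (H : sgraph) : nat := min_pos (embeds_in_product_ex H).

(** * Fractals *)

(* dim_R and dim_P are positive, so the predecessors are not truncated. *)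
Definition dim_L (G : sgraph) : nat := (dim_R G).-1.
Definition dim_H (G : sgraph) : nat := (dim_P (compl G)).-1.

Definition fractal (G : sgraph) : Prop := dim_L G < dim_H G.

(** * Sierpinski gasket graphs *)

Record tetrad := Tetrad {
  tgraph :> sgraph;
  contact1 : tgraph;
  contact2 : tgraph;
  contact3 : tgraph;
  contact_uniq : uniq [:: contact1; contact2; contact3] }.

Arguments contact1 {T} : rename.
Arguments contact2 {T} : rename.
Arguments contact3 {T} : rename.
Arguments contact_uniq T : rename.

Definition c0 : 'I_3 := @Ordinal 3 0 isT.
Definition c1 : 'I_3 := @Ordinal 3 1 isT.
Definition c2 : 'I_3 := @Ordinal 3 2 isT.

Fact triangle_uniq : uniq ([:: c0; c1; c2] : seq (complete 3)).
Proof. by []. Qed.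

Definition triangle : tetrad := Tetrad triangle_uniq.

Section Glue.
Variable T : tetrad.

(* The disjoint union of three copies of T: (c0, v), (c1, v) and (c2, v) are
   the vertices v, v' and v''.  *)
Let copies : finType := ('I_3 * T)%type.

Definition glue_pairs : seq (copies * copies) :=
  [:: ((c0, contact2), (c1, contact1));
      ((c1, contact3), (c2, contact2));
      ((c0, contact3), (c2, contact1))].

Definition glue_rel : rel copies :=
  fun p q => ((p, q) \in glue_pairs) || ((q, p) \in glue_pairs).

(* The equivalence relation generated by the three identifications. *)
Definition glue_equiv : rel copies := connect glue_rel.

Fact glue_rel_sym : symmetric glue_rel.
Proof. by move=> p q; rewrite /glue_rel orbC. Qed.

Fact glue_equiv_sym : symmetric glue_equiv.
Proof. exact: (sym_connect_sym glue_rel_sym). Qed.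

Canonical glue_equivRel :=
  EquivRel glue_equiv (@connect0 _ glue_rel) glue_equiv_sym
           (@connect_trans _ glue_rel).

Definition glue_vertex := {eq_quot glue_equivRel}.

HB.instance Definition _ := EqQuotient.on glue_vertex.
HB.instance Definition _ := Choice.on glue_vertex.
HB.instance Definition _ :=
  Countable.copy glue_vertex (can_type (@reprK _ glue_vertex)).
HB.instance Definition _ :=
  isFinite.Build glue_vertex (pcan_enumP (can_pcan (@reprK _ glue_vertex))).

Definition glue_pi (p : copies) : glue_vertex := \pi_(glue_vertex) p.

(* Edges are the images of the edges of the three copies. *)
Definition glue_adj : rel glue_vertex := fun u v =>
  [exists i : 'I_3, [exists a : T, [exists b : T,
    [&& adj a b, glue_pi (i, a) == u & glue_pi (i, b) == v]]]].

Lemma glue_piP (p q : copies) : reflect (glue_pi p = glue_pi q) (glue_equiv p q).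
Proof. exact: eqmodP. Qed.

Lemma glue_equivE (p q : copies) : glue_equiv p q = (p == q) || glue_rel p q.
Proof.
apply/idP/idP; last by case/orP=> [/eqP->|]; [exact: connect0|exact: connect1].
case/connectP=> s; elim: s p => [|r s IHs] p /=; first by move=> _ ->; rewrite eqxx.
case/andP=> pr rs qE; have /orP[/eqP <-|rq] := IHs r rs qE; first by rewrite pr orbT.
move: pr rq; have := contact_uniq T.
rewrite /= !inE negb_or andbT => /andP[/andP[n12 n13] n23].
have [n21 n31 n32] : [/\ contact2 != contact1 :> T, contact3 != contact1 :> T
  & contact3 != contact2 :> T] by split; rewrite eq_sym.
have N := (negPf n12, negPf n13, negPf n23, negPf n21, negPf n31, negPf n32).
rewrite /glue_rel /glue_pairs !inE !xpair_eqE.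
case: p q r {IHs rs qE} => [i a] [j b] [k c].
rewrite !xpair_eqE.
by case/orP=> /or3P[] /andP[] /andP[] /eqP-> /eqP-> /andP[] /eqP-> /eqP->;
  rewrite ?N /= ?eqxx ?andbF ?andbT ?orbF ?orFb /= => /andP[/eqP-> /eqP->];
  rewrite !eqxx.
Qed.

Lemma glue_pi_inj (i : 'I_3) : injective (fun a : T => glue_pi (i, a)).
Proof.
move=> a b /glue_piP; rewrite glue_equivE => /orP[/eqP[]//|].
rewrite /glue_rel /glue_pairs !inE !xpair_eqE.
by case/orP=> /or3P[] /andP[] /andP[] /eqP-> _ /andP[].
Qed.

Fact glue_adj_sym : symmetric glue_adj.
Proof.
suff H u v : glue_adj u v -> glue_adj v u by move=> u v; apply/idP/idP; apply: H.
case/existsP=> i /existsP[a /existsP[b /and3P[ab au bv]]].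
apply/existsP; exists i; apply/existsP; exists b; apply/existsP; exists a.
by rewrite adj_sym ab bv au.
Qed.

Fact glue_adj_irrefl : irreflexive glue_adj.
Proof.
move=> u; apply/negbTE/negP; case/existsP=> i /existsP[a /existsP[b]].
case/and3P=> ab /eqP<- /eqP/glue_pi_inj ba.
by rewrite ba adj_irrefl in ab.
Qed.

Definition glue_graph : sgraph := SGraph glue_adj_sym glue_adj_irrefl.

Fact glue_contact_uniq :
  uniq ([:: glue_pi (c0, contact1); glue_pi (c1, contact2);
            glue_pi (c2, contact3)] : seq glue_graph).
Proof.
have := contact_uniq T.
rewrite /= !inE negb_or andbT => /andP[/andP[n12 n13] n23].
have [n21 n31 n32] : [/\ contact2 != contact1 :> T, contact3 != contact1 :> T
  & contact3 != contact2 :> T] by split; rewrite eq_sym.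
have N := (negPf n12, negPf n13, negPf n23, negPf n21, negPf n31, negPf n32).
have piE (p q : copies) : (glue_pi p == glue_pi q) = (p == q) || glue_rel p q.
  by rewrite -glue_equivE; apply/eqP/glue_piP.
by rewrite !piE /glue_rel /glue_pairs !inE !xpair_eqE /= ?N ?andbF.
Qed.

Definition glue : tetrad := Tetrad glue_contact_uniq.
End Glue.

(* T_n for n >= 1; the value at n = 0 is junk, equal to T_1.  *)
Definition gasket_tetrad (n : nat) : tetrad := iter n.-1 glue triangle.

Definition gasket (n : nat) : sgraph := tgraph (gasket_tetrad n).

(* Main.v *)
(* An embedding of the complement of G into a product of d complete graphs
   amounts to d equivalence relations on the vertices whose classes are
   cliques of G, that jointly cover the edges and jointly separate the
   vertices.  Colouring the elementary triangles of S_n (n >= 2) by their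
   position inside their copy of S_2 gives triangles that meet distinct
   colours: the corner triangle of S_n at the contact vertex x_k has colour k,
   and copy i is glued at its corner j to copy j at its corner i.  Since every
   vertex misses some colour, the three relations separate vertices, and their
   nontrivial classes form a clique 2-cover.  Conversely S_n contains an
   induced diamond.  A path of length two rules out a clique 1-cover; with two
   equivalence relations each triangle would be monochromatic by pigeonhole,
   so the two triangles of the diamond, which share an edge, would merge. *)
Require Import Defs.
From mathcomp Require Import all_boot.

Set Implicit Arguments.
Unset Strict Implicit.
Unset Printing Implicit Defensive.

(** * Three-element index set and minimal integers *)

Lemma ord3P (P : 'I_3 -> Prop) : P c0 -> P c1 -> P c2 -> forall i, P i.
Proof.
by move=> P0 P1 P2 [[|[|[|//]]] lt_i]; rewrite (bool_irrelevance lt_i isT).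
Qed.

Lemma ord3_third (i j : 'I_3) : exists k, (k != i) && (k != j).
Proof.
by move: i j; do 2!apply: ord3P;
  solve [by exists c0 | by exists c1 | by exists c2].
Qed.

Lemma min_pos_eq (P : nat -> Prop) (exP : exists k, 0 < k /\ P k) (d : nat) :
  0 < d -> P d -> (forall k, 0 < k < d -> ~ P k) -> min_pos exP = d.
Proof.
move=> d0 Pd Pmin; have [m0 Pm le_m] := min_posP exP.
apply/eqP; rewrite eqn_leq le_m //= leqNgt; apply/negP => m_lt.
by apply: (Pmin _ _ Pm); rewrite m0.
Qed.

(** * Contact vertices and the geometry of gluing *)

Definition contact (T : tetrad) (i : 'I_3) : T :=
  nth contact1 [:: contact1; contact2; contact3] i.

Lemma contact_inj (T : tetrad) : injective (@contact T).
Proof.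
by move=> i j /eqP; rewrite nth_uniq ?ltn_ord ?contact_uniq // => /eqP/val_inj.
Qed.

Lemma contact_glue (T : tetrad) (i : 'I_3) :
  contact (glue T) i = glue_pi (i, contact T i).
Proof. by move: i; apply: ord3P. Qed.

(** Indexing contacts by ['I_3] turns the three identifications into one rule symmetric in [i] and
    [j]. *)
Lemma glue_pi_contact (T : tetrad) (i j : 'I_3) :
  i != j -> glue_pi (i, contact T j) = glue_pi (j, contact T i).
Proof.
move=> ij; apply/glue_piP; rewrite glue_equivE /glue_rel /glue_pairs !inE.
by move: i j ij; do 2!apply: ord3P => //=; rewrite /contact /= !eqxx ?orbT.
Qed.

Lemma glue_pi_neq (T : tetrad) (i j : 'I_3) (a b : T) :
  i != j -> glue_pi (i, a) = glue_pi (j, b) -> a = contact T j /\ b = contact T i.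
Proof.
move=> ij /glue_piP; rewrite glue_equivE xpair_eqE (negPf ij) /=.
rewrite /glue_rel /glue_pairs !inE !xpair_eqE.
by case/orP=> /or3P[] /andP[] /andP[] /eqP-> /eqP-> /andP[] /eqP-> /eqP->.
Qed.

Lemma glue_vertexP (T : tetrad) (u : glue T) : exists i a, u = glue_pi (i, a).
Proof.
by case: (repr u) (reprK u) => i a <-; exists i, a.
Qed.

Lemma glue_adjP (T : tetrad) (u v : glue T) :
  reflect (exists i a b, [/\ adj a b, u = glue_pi (i, a) & v = glue_pi (i, b)])
          (adj u v).
Proof.
apply: (iffP existsP) => [[i /existsP[a /existsP[b /and3P[ab /eqP<- /eqP<-]]]]|].
  by exists i, a, b.
move=> [i [a [b [ab -> ->]]]]; exists i.
by apply/existsP; exists a; apply/existsP; exists b; rewrite ab !eqxx.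
Qed.

(** Two copies share only one vertex, so an edge inside copy [i] cannot come from another copy. *)
Lemma glue_pi_mono (T : tetrad) (i : 'I_3) :
  {mono (fun a : T => glue_pi (i, a) : glue T) : a b / adj a b}.
Proof.
move=> a b; apply/glue_adjP/idP => [[j [a' [b' [ab' aE bE]]]]|ab]; last first.
  by exists i, a, b.
have [ij|ij] := eqVneq i j.
  by rewrite -ij in aE bE; rewrite (glue_pi_inj aE) (glue_pi_inj bE).
have [_ a'E] := glue_pi_neq ij aE; have [_ b'E] := glue_pi_neq ij bE.
by rewrite a'E b'E adj_irrefl in ab'.
Qed.

(** * Edge partitions into three equivalence relations *)

Definition isolated (T : Type) (r : rel T) (v : T) := forall w, r v w -> w = v.

(** By [ep_adj] all classes are cliques. [ep_isolated] serves twice: it separates vertices in the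
    product and bounds the clique cover by 2. *)
Record edge_partition (G : sgraph) (e : 'I_3 -> rel G) : Prop := EdgePartition {
  ep_equiv : forall k, equivalence_rel (e k);
  ep_adj : forall u v, adj u v = (u != v) && [exists k, e k u v];
  ep_isolated : forall v, exists k, isolated (e k) v }.

(* Copy [i] is partitioned by [e i]: on [S_1] the three copies need different
   colours, whereas from [S_2] on they are all coloured in the same way. *)
Record gluable (T : tetrad) (e : 'I_3 -> 'I_3 -> rel T) : Prop := Gluable {
  gl_partition : forall i, edge_partition (e i);
  gl_corner : forall i k, k != i -> isolated (e i k) (contact T i);
  gl_side : forall i j k, i != j ->
    isolated (e i k) (contact T j) \/ isolated (e j k) (contact T i);
  gl_free : forall i j, i != j -> exists k,
    isolated (e i k) (contact T j) /\ isolated (e j k) (contact T i) }.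

Lemma triangle_gluable :
  gluable (fun i k (a b : triangle) => (i == k) || (a == b)).
Proof.
have iso (i k : 'I_3) (v : triangle) : k != i ->
    isolated (fun a b => (i == k) || (a == b)) v.
  by move=> ki w; rewrite eq_sym (negPf ki) /= => /eqP.
split.
- move=> i; split.
  + move=> k u v w; split; first by rewrite eqxx orbT.
    by case: (i == k) => //= /eqP->.
  + move=> u v; rewrite [LHS]/=; case: (u != v) => //=.
    by apply/esym/existsP; exists i; rewrite eqxx.
  + by move=> v; have [k /andP[ki _]] := ord3_third i i; exists k; apply: iso.
- by move=> i k ki; apply: iso.
- move=> i j k ij; have [->|/eqP ki] := k =P i; [right | left];
    exact: iso.
- move=> i j _; have [k /andP[ki kj]] := ord3_third i j.
  by exists k; split; apply: iso.
Qed.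

(** * Gluing edge partitions *)

Section GlueColours.
Variables (T : tetrad) (e : 'I_3 -> 'I_3 -> rel T).
Hypothesis e_gluable : gluable e.

(** No transitive closure is taken: [gl_side] keeps classes from merging across copies. *)
Definition glue_colour (k : 'I_3) : rel (glue T) := fun u v =>
  (u == v) || [exists i : 'I_3, [exists a : T, [exists b : T,
    [&& e i k a b, glue_pi (i, a) == u & glue_pi (i, b) == v]]]].

Lemma glue_colourP k (u v : glue T) :
  reflect (u = v \/ exists i a b, [/\ e i k a b, u = glue_pi (i, a)
                                     & v = glue_pi (i, b)])
          (glue_colour k u v).
Proof.
apply: (iffP orP) => [[/eqP|]|[->|[i [a [b [ab -> ->]]]]]]; [by left | | by left |].
  case/existsP=> i /existsP[a /existsP[b /and3P[ab /eqP<- /eqP<-]]].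
  by right; exists i, a, b.
right; apply/existsP; exists i; apply/existsP; exists a.
by apply/existsP; exists b; rewrite ab !eqxx.
Qed.

Let e_refl i k a : e i k a a.
Proof. by have [e_eqv _ _] := gl_partition e_gluable i; case: (e_eqv k a a a). Qed.

Let e_sym i k a b : e i k a b -> e i k b a.
Proof.
have [e_eqv _ _] := gl_partition e_gluable i.
by move=> ab; have [_ /(_ ab) <-] := e_eqv k a b a; apply: e_refl.
Qed.

Let e_trans i k a b c : e i k a b -> e i k b c -> e i k a c.
Proof.
have [e_eqv _ _] := gl_partition e_gluable i.
by move=> ab; have [_ /(_ ab) ->] := e_eqv k a b c.
Qed.

Lemma glue_colour_sym k (u v : glue T) : glue_colour k u v -> glue_colour k v u.
Proof.
case/glue_colourP=> [->|[i [a [b [ab -> ->]]]]]; apply/glue_colourP; first by left.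
by right; exists i, b, a; split=> //; apply: e_sym.
Qed.

Lemma glue_colour_trans k (u v w : glue T) :
  glue_colour k u v -> glue_colour k v w -> glue_colour k u w.
Proof.
case/glue_colourP=> [->//|[i [a [b [ab uE vE]]]]].
case/glue_colourP=> [<-|[j [b' [c [bc vE' wE]]]]].
  by apply/glue_colourP; right; exists i, a, b.
have [ij|ij] := eqVneq i j.
  rewrite -{j}ij {}vE in bc vE' wE; have bb := glue_pi_inj vE'.
  apply/glue_colourP; right; exists i, a, c; split=> //.
  by apply: e_trans ab _; rewrite bb.
have [bE b'E] := glue_pi_neq ij (etrans (esym vE) vE').
(* The middle vertex is where copies [i] and [j] meet; it is isolated on one side, so one of the two
   steps is an equality. *)
case: (gl_side e_gluable k ij) => iso; apply/glue_colourP; right.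
  exists j, b', c; split=> //; rewrite -vE' vE uE.
  by move/e_sym: ab; rewrite bE => /iso->.
exists i, a, b; split=> //; rewrite -vE vE' wE.
by move: bc; rewrite b'E => /iso->.
Qed.

Lemma glue_colour_equiv k : equivalence_rel (glue_colour k).
Proof.
move=> u v w; split; first by rewrite /glue_colour eqxx.
move=> uv; apply/idP/idP; apply: glue_colour_trans => //.
exact: glue_colour_sym.
Qed.

Lemma glue_colour_isolated k i a :
  isolated (e i k) a ->
  (forall j, i != j -> a = contact T j -> isolated (e j k) (contact T i)) ->
  isolated (glue_colour k) (glue_pi (i, a)).
Proof.
move=> iso_a iso_x w /glue_colourP[//|[j [b [c [bc aE ->]]]]].
have [ij|ij] := eqVneq i j.
  rewrite -{j}ij in bc aE *; rewrite (glue_pi_inj aE) in iso_a *.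
  by rewrite (iso_a _ bc).
have [aE' bE] := glue_pi_neq ij aE.
by rewrite aE; rewrite bE in bc *; rewrite (iso_x j ij aE' c bc).
Qed.

Lemma glue_edge_partition : edge_partition glue_colour.
Proof.
split; first exact: glue_colour_equiv.
- move=> u v; apply/glue_adjP/andP.
    move=> [i [a [b [ab -> ->]]]]; split.
      by apply: contraTneq ab => /glue_pi_inj->; rewrite adj_irrefl.
    move: ab; rewrite (ep_adj (gl_partition e_gluable i)).
    case/andP=> _ /existsP[k ab]; apply/existsP; exists k.
    by apply/glue_colourP; right; exists i, a, b.
  move=> [uv /existsP[k /glue_colourP[/eqP|]]]; first by rewrite (negPf uv).
  move=> [i [a [b [ab uE vE]]]]; exists i, a, b; split=> //.
  rewrite (ep_adj (gl_partition e_gluable i)); apply/andP; split.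
    by apply: contraNneq uv => ab'; rewrite uE vE ab'.
  by apply/existsP; exists k.
- move=> v; have [i [a ->]] := glue_vertexP v.
  (* A glued vertex takes the colour free in both copies; any other keeps its free colour from copy
     [i]. *)
  case: (pickP (fun j => (i != j) && (a == contact T j))) => [j|no_j].
    case/andP=> ij /eqP aE; have [k [iso_i iso_j]] := gl_free e_gluable ij.
    exists k; apply: glue_colour_isolated; first by rewrite aE.
    by move=> j' _; rewrite aE => /contact_inj <-.
  have [k iso_a] := ep_isolated (gl_partition e_gluable i) a.
  exists k; apply: glue_colour_isolated => // j ij aE.
  by have := no_j j; rewrite ij aE eqxx.
Qed.

(** Corner [i] of the result is corner [i] of copy [i], so only colour [i] can occur there. At the
    next gluing corner [j] meets corner [i]: their colours differ and the third one is free. *)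
Lemma glue_gluable : gluable (fun _ => glue_colour).
Proof.
have iso i k : k != i -> isolated (glue_colour k) (contact (glue T) i).
  move=> ki; rewrite contact_glue; apply: glue_colour_isolated.
    exact: gl_corner.
  by move=> j ij /contact_inj ijE; rewrite ijE eqxx in ij.
split; [by move=> _; apply: glue_edge_partition | by [] | |].
- move=> i j k ij; have [->|kj] := eqVneq k j; [right | left];
    by apply: iso; rewrite // eq_sym.
- move=> i j _; have [k /andP[ki kj]] := ord3_third i j.
  by exists k; split; apply: iso.
Qed.
End GlueColours.

Lemma gasket_gluable (n : nat) :
  exists e : 'I_3 -> 'I_3 -> rel (gasket_tetrad n), gluable e.
Proof.
rewrite /gasket_tetrad; elim: n.-1 => [|m [e e_gl]].
  by eexists; apply: triangle_gluable.
by eexists; apply: (glue_gluable e_gl).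
Qed.

(** * Upper bounds from an edge partition *)

Section EdgePartition.
Variables (G : sgraph) (e : 'I_3 -> rel G).
Hypothesis eP : edge_partition e.

Let class k u : {set G} := [set w | e k u w].

Let classP k u v : reflect (class k u = class k v) (e k u v).
Proof.
have eqv := ep_equiv eP k; apply: (iffP idP) => [uv|/setP/(_ v)].
  by apply/setP => w; rewrite !inE; have [_ ->] := eqv u v w.
by rewrite !inE => ->; have [] := eqv v v v.
Qed.

(** Coordinate [k] of a vertex is its class for colour [k]. A colour isolated at [u] has class
    [{u}], hence injectivity. *)
Lemma edge_partition_embeds : embeds_in_product (compl G) 3.
Proof.
pose m := #|{set G}|; pose c k u : 'I_m := enum_rank (class k u).
have cE k u v : (c k u == c k v) = e k u v.
  by rewrite (inj_eq enum_rank_inj); apply/eqP/classP.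
exists m, [:: m; m]; split=> //.
apply: (@giso_induced (complete_prod m [:: m; m]) (compl G)
          (fun u => (c c0 u, (c c1 u, c c2 u)))).
  move=> u v [] uv0 uv1 uv2; have [k iso_u] := ep_isolated eP u.
  apply/esym/iso_u; rewrite -cE; apply/eqP.
  by move: k {iso_u}; apply: ord3P; apply: enum_val_inj; rewrite ?uv0 ?uv1 ?uv2.
move=> u v; rewrite /adj /= !cE (ep_adj eP).
have -> : [exists k, e k u v] = [|| e c0 u v, e c1 u v | e c2 u v].
  apply/existsP/or3P => [[k]|[uv|uv|uv]]; last first.
  - by exists c2.
  - by exists c1.
  - by exists c0.
  move: k; apply: ord3P; [exact: Or31 | exact: Or32 | exact: Or33].
have [<-|_] /= := eqVneq u v; last by rewrite !negb_or.
by have [-> _] := ep_equiv eP c0 u u u.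
Qed.

Lemma edge_partition_cover : has_clique_cover G 2.
Proof.
(* Covers count multiplicity, hence [undup]. Dropping singletons removes the isolated colour from
   the count at a vertex. *)
pose Fk k := [seq C : {set G} <- undup [seq class k u | u <- enum G] | 1 < #|C|].
have Fk_class k v C : C \in Fk k -> v \in C -> C = class k v.
  rewrite mem_filter mem_undup => /andP[_ /mapP[u _ ->]].
  by rewrite inE => /classP.
have count_le1 k v : count (fun C : {set G} => v \in C) (Fk k) <= 1.
  have uF : uniq (Fk k) by rewrite filter_uniq ?undup_uniq.
  move: (Fk k) uF (Fk_class k v) => F uF F_class.
  apply: leq_trans (leq_b1 (class k v \in F)); rewrite -(count_uniq_mem _ uF).
  rewrite -!size_filter; apply: uniq_leq_size; first exact: filter_uniq.
  move=> C; rewrite !mem_filter /= => /andP[vC CF].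
  by rewrite CF (F_class C) ?eqxx.
have count_iso k v : isolated (e k) v -> count (fun C : {set G} => v \in C) (Fk k) = 0.
  move=> iso; apply/eqP; rewrite -leqn0 leqNgt -has_count.
  apply/hasPn => C CF; apply/negP => vC; have CE := Fk_class k v C CF vC.
  move: CF; rewrite mem_filter => /andP[+ _]; rewrite ltnNge => /negP; apply.
  by rewrite -(cards1 v) subset_leq_card // CE; apply/subsetP=> w; rewrite !inE => /iso->.
exists (flatten [seq Fk k | k <- enum 'I_3]); split.
- move=> C /flatten_mapP[k _ CF] u v uC vC uv.
  rewrite (ep_adj eP) uv; apply/existsP; exists k.
  by have := vC; rewrite (Fk_class _ _ _ CF uC) inE.
- move=> u v uv; have := uv; rewrite (ep_adj eP) => /andP[neq_uv /existsP[k euv]].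
  have uu : e k u u by have [] := ep_equiv eP k u u u.
  exists (class k u); last by rewrite !inE uu.
  apply/flatten_mapP; exists k; rewrite ?mem_enum // mem_filter mem_undup.
  rewrite map_f ?mem_enum // andbT; have := cards2 u v; rewrite neq_uv => <-.
  apply: subset_leq_card; apply/subsetP=> w; rewrite !inE.
  by case/orP=> /eqP->.
move=> v; have [k0 iso] := ep_isolated eP v.
have countE : count (fun C : {set G} => v \in C) (flatten [seq Fk k | k <- enum 'I_3])
    = \sum_(k < 3) count (fun C : {set G} => v \in C) (Fk k).
  by rewrite count_flatten sumnE -map_comp big_map big_enum.
rewrite countE (bigD1 k0) //= count_iso // add0n.
apply: (@leq_trans (\sum_(k < 3 | k != k0) 1)); first by apply: leq_sum => k _.
by rewrite sum1_card cardC1 card_ord.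
Qed.
End EdgePartition.

(** * Lower bounds from an induced diamond *)

Definition diamond (G : sgraph) (p a b c : G) : Prop :=
  [/\ [&& adj p a, adj p b & adj a b], adj a c, adj b c & (p != c) && ~~ adj p c].

(** The cliques covering [pa] and [ac] share [a]; if they coincided, [p] and [c] would be
    adjacent. *)
Lemma diamond_cover (G : sgraph) (p a b c : G) :
  diamond p a b c -> ~ has_clique_cover G 1.
Proof.
move=> [/and3P[pa _ _] ac _ /andP[pc npc]] [F [F_clique F_edge F_count]].
have [C CF /andP[pC aC]] := F_edge _ _ pa.
have [D DF /andP[aD cD]] := F_edge _ _ ac.
have eqCD : C = D.
  apply/eqP; apply: contraTT (F_count a) => neqCD; rewrite -ltnNge -size_filter.
  have sub : {subset [:: C; D] <= [seq E : {set G} <- F | a \in E]}.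
    by move=> E; rewrite !inE mem_filter => /orP[]/eqP->; apply/andP.
  by apply: (uniq_leq_size _ sub); rewrite /= inE neqCD.
by move/negP: npc; apply; apply: (F_clique C CF) => //; rewrite eqCD.
Qed.

Lemma embeds_le2 (H : sgraph) (d : nat) :
  0 < d < 3 -> embeds_in_product H d -> exists f g : H -> nat,
    (forall u v, adj u v = (f u != f v) && (g u != g v)) /\
    (forall u v, f u = f v -> g u = g v -> u = v).
Proof.
move=> d_bnd [m [s [sE [A [h [h_bij h_mono]]]]]].
have h_inj := bij_inj h_bij.
move: s => [|m' [|m'' s]] in sE A h h_bij h_mono h_inj *; last first.
- by rewrite -sE in d_bnd.
- exists (fun u => @nat_of_ord m (val (h u)).1), (fun u => @nat_of_ord m' (val (h u)).2).
  split.
    by move=> u v; rewrite -h_mono.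
  move=> u v f_uv g_uv; apply/h_inj/val_inj.
  by rewrite [LHS]surjective_pairing [RHS]surjective_pairing (val_inj f_uv) (val_inj g_uv).
(* For [d = 1] the single coordinate serves as both colourings. *)
- exists (fun u => @nat_of_ord m (val (h u))), (fun u => @nat_of_ord m (val (h u))).
  split.
    by move=> u v; rewrite andbb -h_mono.
  by move=> u v f_uv _; apply/h_inj/val_inj/val_inj.
Qed.

Lemma diamond_embeds (G : sgraph) (p a b c : G) (d : nat) :
  diamond p a b c -> 0 < d < 3 -> ~ embeds_in_product (compl G) d.
Proof.
move=> [/and3P[pa pb ab] ac bc /andP[neq_pc npc]] d_bnd /(embeds_le2 d_bnd).
move=> [f [g [fgE fg_inj]]].
have adjE (u v : G) : u != v -> adj u v = (f u == f v) || (g u == g v).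
  move=> uv; have := fgE u v; rewrite {1}/adj /= uv /= => /(congr1 negb).
  by rewrite negbK negb_and !negbK.
(* Agreement in both coordinates would identify the ends, so each edge has exactly one colour, [f]
   or [g]. *)
have edge (u v : G) : adj u v -> (f u == f v) (+) (g u == g v).
  move=> uv; have neq_uv : u != v by apply: contraTneq uv => ->; rewrite adj_irrefl.
  have := uv; rewrite adjE //.
  case: eqP => [fuv|_]; case: eqP => [guv|_] //= _.
  by rewrite (fg_inj u v) ?eqxx in neq_uv.
(* Two of the three edges of a triangle share a colour, and transitivity of equality passes it to
   the third. *)
have mono (u v w : G) : adj u v -> adj v w -> adj u w -> (f u == f v) = (f v == f w).
  move=> /edge + /edge + /edge.
  have [->|fuv] := eqVneq (f u) (f v); have [fvw|fvw] := eqVneq (f v) (f w) => //=.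
    by move=> /negPf guv /eqP <-; rewrite guv.
  by rewrite -fvw (negPf fuv) /= => /eqP-> /negPf->.
(* The triangles [pab] and [bac] share the edge [ab], hence its colour. *)
have pa_ac : (f p == f a) = (f a == f c).
  by rewrite (mono p a b) // eq_sym (mono b a c) // adj_sym.
move: npc (edge _ _ pa) (edge _ _ ac); rewrite adjE // -pa_ac.
move: pa_ac; have [->|_] /= := eqVneq (f p) (f a); first by move=> <-.
by move=> _ npc /eqP gpa /eqP gac; rewrite gpa gac eqxx orbT in npc.
Qed.

(** * Diamonds in the gaskets, and the dimensions *)

Lemma glue_diamond (T : tetrad) (p a b c : T) :
  diamond p a b c -> exists p' a' b' c' : glue T, diamond p' a' b' c'.
Proof.
move=> pabc.
exists (glue_pi (c0, p)), (glue_pi (c0, a)), (glue_pi (c0, b)), (glue_pi (c0, c)).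
by rewrite /diamond !glue_pi_mono (inj_eq (@glue_pi_inj T c0)).
Qed.

Lemma gasket_diamond (n : nat) :
  2 <= n -> exists p a b c : gasket n, diamond p a b c.
Proof.
case: n => [|[|n _]] //; elim: n => [|n [p [a [b [c]]]]].
  2: exact: (@glue_diamond (gasket_tetrad n.+2)).
pose t i j : glue triangle := glue_pi (i, contact triangle j).
have t_glue i j : i != j -> t i j = t j i by apply: glue_pi_contact.
have t_adj i j k : j != k -> adj (t i j) (t i k).
  by rewrite -(inj_eq (@contact_inj triangle)) /t glue_pi_mono.
have corner_neq i x : i != c0 -> t c0 c0 <> glue_pi (i, x).
  rewrite eq_sym => i0 /(glue_pi_neq i0)[/contact_inj i0E].
  by rewrite -i0E in i0.
(* The outer corner of copy [c0], then the three glued vertices, which form the middle triangle with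
   one edge in each copy. The corner lies in copy [c0] only and [t c1 c2] lies outside it, so they
   are not adjacent. *)
exists (t c0 c0), (t c0 c1), (t c0 c2), (t c1 c2); split.
- by rewrite !t_adj.
- by rewrite t_glue // t_adj.
- by rewrite t_glue // (t_glue c1) // t_adj.
- apply/andP; split; first by apply/eqP/corner_neq.
  apply/negP => /glue_adjP[i [x [y [_ pE cE]]]].
  have [i0|i0] := eqVneq i c0; last exact: corner_neq i0 pE.
  rewrite i0 in cE; have [/contact_inj] // := glue_pi_neq (isT : c1 != c0) cE.
Qed.

Theorem proposition7 (n : nat) :
  2 <= n ->
  [/\ fractal (gasket n), dim_L (gasket n) = 1 & dim_H (gasket n) = 2].
Proof.
move=> n2; have [e e_gl] := gasket_gluable n.
have eP := gl_partition e_gl c0.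
have [p [a [b [c pabc]]]] := gasket_diamond n2.
have RE : dim_R (gasket n) = 2.
  apply: min_pos_eq => // [|[|[|k]] // _]; first exact: edge_partition_cover eP.
  exact: diamond_cover pabc.
have PE : dim_P (compl (gasket n)) = 3.
  apply: min_pos_eq => // [|d d_bnd]; first exact: edge_partition_embeds eP.
  exact: diamond_embeds pabc d_bnd.
by rewrite /fractal /dim_L /dim_H RE PE.
Qed.
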